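(* Let $\Omega$ be a linear functional on $\mathbb{C}_{2N}[\lambda]$, let $s_l=\langle\Omega,\lambda^l\rangle$ for $l=0,1,\dots,2N$, and let $$D_n=\det\big(s_{i+j}\big)_{i,j=0}^{n},\qquad n=0,1,\dots,N.$$ In order for $\Omega$ to be the generalized spectral function of some Jacobi matrix $J$ with entries $a_n,b_n\in\mathbb{C}$, $a_n\ne0$, it is necessary and sufficient that $$D_0=1,\qquad D_n\ne0\quad(n=1,2,\dots,N-1),\qquad\text{and}\qquad D_N=0.$$
   Context: $N$ is a positive integer. A (complex) Jacobi matrix $J$ here is an $N\times N$ symmetric tridiagonal matrix (rows and columns indexed $0,\dots,N-1$) with diagonal entries $b_0,\dots,b_{N-1}\in\mathbb{C}$, with nonzero entries $a_n\in\mathbb{C}$ in positions $(n,n+1)$ and $(n+1,n)$ for $0\le n\le N-2$, and zeros elsewhere. Put $a_{N-1}=1$. The polynomials $P_0(\lambda),\dots,P_N(\lambda)$ associated with $J$ are defined by $P_0(\lambda)=1$, $b_0P_0(\lambda)+a_0P_1(\lambda)=\lambda P_0(\lambda)$, $a_{n-1}P_{n-1}(\lambda)+b_nP_n(\lambda)+a_nP_{n+1}(\lambda)=\lambda P_n(\lambda)$ for $n\in\{1,\dots,N-1\}$. $\mathbb{C}_m[\lambda]$ is the space of polynomials of degree $\le m$ with complex coefficients; $\langle\Omega,G(\lambda)\rangle$ denotes the value of the linear functional $\Omega$ at $G$. The generalized spectral function of $J$ is the unique linear functional $\Omega:\mathbb{C}_{2N}[\lambda]\to\mathbb{C}$ such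 that $\langle\Omega,P_mP_n\rangle=\delta_{mn}$ for $m,n\in\{0,\dots,N-1\}$ and $\langle\Omega,P_mP_N\rangle=0$ for $m\in\{0,\dots,N\}$. *)

(* Defs.v *)
From HB Require Import structures.
From mathcomp Require Import all_boot all_order all_algebra.
From mathcomp Require Import reals complex.

Set Implicit Arguments.
Unset Strict Implicit.
Unset Printing Implicit Defensive.

Import GRing.Theory.
Local Open Scope ring_scope.

Section Jacobi.
Variables (C : fieldType) (N : nat).

Definition is_jacobi (J : 'M[C]_N) : Prop :=
  [/\ J^T = J,
      forall i j : 'I_N, (i.+1 < j)%N -> J i j = 0
    & forall i j : 'I_N, j = i.+1 :> nat -> J i j != 0].

(* The junk value 0 is only taken for n >= N, where b_n does not exist. *)
Definition jacobi_b (J : 'M[C]_N) (n : nat) : C :=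
  if insub n is Some i then J i i else 0.

(* a_n = J n n.+1 for n.+1 < N; the default value provides the convention
   a_(N-1) = 1. *)
Definition jacobi_a (J : 'M[C]_N) (n : nat) : C :=
  if (insub n, insub n.+1) is (Some i, Some j) then J i j else 1.

(* The three-term recurrence solved for its last term, see jacobi_polyE0 and
   jacobi_polyES; only the indices n <= N are meaningful. *)
Fixpoint jacobi_poly (J : 'M[C]_N) (n : nat) : {poly C} :=
  match n with
  | 0 => 1
  | k.+1 =>
    (jacobi_a J k)^-1 *:
      (('X - (jacobi_b J k)%:P) * jacobi_poly J k
       - match k with
         | 0 => 0
         | m.+1 => jacobi_a J m *: jacobi_poly J m
         end)
  end.

Lemma jacobi_a_neq0 (J : 'M[C]_N) (n : nat) : is_jacobi J -> jacobi_a J n != 0.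
Proof.
case=> _ _ Ja; rewrite /jacobi_a.
case: insubP => [i _ ni|_]; last exact: oner_neq0.
case: insubP => [j _ nj|_]; last exact: oner_neq0.
by apply: Ja; rewrite ni.
Qed.

Lemma jacobi_polyE0 (J : 'M[C]_N) : is_jacobi J ->
  jacobi_b J 0 *: jacobi_poly J 0 + jacobi_a J 0 *: jacobi_poly J 1
  = 'X * jacobi_poly J 0.
Proof.
move=> hJ; rewrite /= [X in _ + X]scalerA mulfV ?jacobi_a_neq0// scale1r.
rewrite !mulr1 subr0; by rewrite alg_polyC addrC subrK.
Qed.

Lemma jacobi_polyES (J : 'M[C]_N) (n : nat) : is_jacobi J ->
  jacobi_a J n *: jacobi_poly J n + jacobi_b J n.+1 *: jacobi_poly J n.+1
  + jacobi_a J n.+1 *: jacobi_poly J n.+2 = 'X * jacobi_poly J n.+1.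
Proof.
move=> hJ; set p := jacobi_poly J n.+1.
have -> : jacobi_poly J n.+2 = (jacobi_a J n.+1)^-1 *:
    (('X - (jacobi_b J n.+1)%:P) * p - jacobi_a J n *: jacobi_poly J n) by [].
rewrite [X in _ + X]scalerA mulfV ?jacobi_a_neq0// scale1r mulrBl mul_polyC.
by rewrite addrC addrA !subrK.
Qed.

Lemma size_jacobi_poly (J : 'M[C]_N) (n : nat) : is_jacobi J ->
  size (jacobi_poly J n) = n.+1.
Proof.
move=> hJ; suff: size (jacobi_poly J n) = n.+1 /\
  size (jacobi_poly J n.+1) = n.+2 by case.
have step k (p q : {poly C}) : size p = k.+1 -> (size q <= k.+1)%N ->
    forall b, size (('X - b%:P) * p - q) = k.+2.
  move=> sp sq b; have p0 : p != 0 by rewrite -size_poly_gt0 sp.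
  have sXp : size (('X - b%:P) * p) = k.+2.
    by rewrite mulrC size_Mmonic ?monicXsubC// size_XsubC sp addn2.
  by rewrite size_polyDl sXp // size_polyN ltnS.
elim: n => [|n [sn sn1]].
  split; first by rewrite size_poly1.
  rewrite [jacobi_poly J 1]/= size_scale ?invr_eq0 ?jacobi_a_neq0//.
  by apply: step; rewrite ?size_poly1 ?size_poly0.
split=> //; have -> : jacobi_poly J n.+2 = (jacobi_a J n.+1)^-1 *:
    (('X - (jacobi_b J n.+1)%:P) * jacobi_poly J n.+1
     - jacobi_a J n *: jacobi_poly J n) by [].
rewrite size_scale ?invr_eq0 ?jacobi_a_neq0//.
by apply: step => //; rewrite size_scale ?jacobi_a_neq0// sn.
Qed.

(* {poly_(2 * N).+1 C} is the space of polynomials of degree at most 2 * N. *)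
Definition functional : Type := {linear {poly_(2 * N).+1 C} -> C^o}.

(* npolyp truncates polynomials of degree > 2 * N; it is only applied to
   polynomials of degree <= 2 * N (size_jacobi_poly), which it leaves
   unchanged (npolypK). *)
Definition pairing (Omega : functional) (G : {poly C}) : C :=
  Omega (npolyp (2 * N).+1 G).

(* A functional with these properties is unique:
   generalized_spectral_function_uniq. *)
Definition is_generalized_spectral_function
    (J : 'M[C]_N) (Omega : functional) : Prop :=
  (forall m n : nat, (m < N)%N -> (n < N)%N ->
     pairing Omega (jacobi_poly J m * jacobi_poly J n) = (m == n)%:R) /\
  (forall m : nat, (m <= N)%N ->
     pairing Omega (jacobi_poly J m * jacobi_poly J N) = 0).

Lemma generalized_spectral_function_uniq (J : 'M[C]_N) (Om Om' : functional) :
  is_jacobi J ->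
  is_generalized_spectral_function J Om ->
  is_generalized_spectral_function J Om' -> Om =1 Om'.
Proof.
move=> hJ [h1 h2] [h1' h2'].
have agree m n : (m <= N)%N -> (n <= N)%N ->
  pairing Om (jacobi_poly J m * jacobi_poly J n) =
  pairing Om' (jacobi_poly J m * jacobi_poly J n).
  rewrite [(m <= _)%N]leq_eqVlt [(n <= _)%N]leq_eqVlt.
  case/predU1P=> [->|ltm]; case/predU1P=> [->|ltn].
  - by rewrite h2 ?h2'.
  - by rewrite mulrC h2 ?h2' // ltnW.
  - by rewrite h2 ?h2' // ltnW.
  - by rewrite h1 ?h1'.
suff main k : forall p : {poly_(2 * N).+1 C}, (size p <= k)%N -> Om p = Om' p.
  by move=> p; apply: (main (size p)).
elim: k => [|k IHk] p sp.
  have -> : p = 0 by apply/val_inj/eqP; rewrite /= -size_poly_eq0 -leqn0.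
  by rewrite !raddf0.
have [/IHk//|ltkp] := leqP (size p) k.
have spk : size p = k.+1 by apply/eqP; rewrite eqn_leq sp.
have lek : (k <= 2 * N)%N by rewrite -ltnS -spk size_npoly.
pose m := minn k N; pose n := (k - m)%N.
have lemN : (m <= N)%N by exact: geq_minr.
have lenN : (n <= N)%N.
  rewrite /n /m; case: (leqP k N) => lekN; first by rewrite subnn.
  by rewrite leq_subLR addnn -mul2n.
have mnk : (m + n = k)%N by rewrite subnKC // geq_minl.
pose q := jacobi_poly J m * jacobi_poly J n.
have sq : size q = k.+1.
  rewrite size_mul -?size_poly_eq0 ?size_jacobi_poly//.
  by rewrite addSn addnS /= mnk.
pose c := (p : {poly C})`_k / q`_k.
have sqN : (size q <= (2 * N).+1)%N by rewrite sq ltnS.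
pose qN : {poly_(2 * N).+1 C} := npolyp _ q.
have qk0 : q`_k != 0.
  have -> : q`_k = lead_coef q by rewrite lead_coefE sq.
  by rewrite lead_coef_eq0 -size_poly_eq0 sq.
have -> : p = (p - c *: qN) + c *: qN by rewrite subrK.
rewrite [LHS]raddfD [RHS]raddfD /=; congr (_ + _); last first.
  by rewrite [LHS]linearZ [RHS]linearZ /=; congr (_ *: _); exact: agree.
apply: IHk; apply/leq_sizeP => j lekj /=.
rewrite coefB coefZ npolypK//.
move: lekj; rewrite leq_eqVlt => /predU1P[<-|ltkj]; first by rewrite /c divfK ?subrr.
by rewrite !nth_default ?mulr0 ?subrr // ?spk ?sq.
Qed.

Definition moment (Omega : functional) (l : nat) : C := pairing Omega 'X^l.

Definition hankel_det (Omega : functional) (n : nat) : C :=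
  \det (\matrix_(i < n.+1, j < n.+1) moment Omega (i + j)).

End Jacobi.

(* Main.v *)
(** Write the Hankel matrix as [H] and let [q_0, ..., q_n] have degrees
    [0, ..., n].  The triangular matrix [T] of their coefficients satisfies
    [Gram(q) = T H T^T], so the Gram determinant is [D_n] times a nonzero
    square.  Applied to the polynomials of [J] this gives necessity.  For
    sufficiency, orthonormalize by the three-term recurrence: as long as [D_n]
    does not vanish, the next polynomial has nonzero square pairing and can be
    normalized by a complex square root, while [D_N = 0] says that the last
    one is isotropic. *)

Require Import Defs.
From HB Require Import structures.
From mathcomp Require Import all_boot all_order all_algebra.
From mathcomp Require Import reals complex.
From mathcomp Require Import zify.

Import GRing.Theory Num.Theory.
Local Open Scope ring_scope.

(** * Gram and Hankel determinants of a linear functional *)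

(** Truncation by [npolyp] is linear, so the pairing is a linear form on all polynomials and the
    lemmas below need not track the bound [2 * N]. *)
Lemma pairing_is_scalar {C : fieldType} {N : nat} (Omega : functional C N) :
  scalar (pairing Omega).
Proof.
move=> c p q; rewrite /pairing.
have -> : npolyp (2 * N).+1 (c *: p + q)
    = c *: npolyp (2 * N).+1 p + npolyp (2 * N).+1 q.
  apply/val_inj/polyP => i /=; rewrite !(coefD, coefZ, coef_npolyp).
  by case: ifP => _ //=; rewrite mulr0 addr0.
exact: (linearP Omega).
Qed.

HB.instance Definition _ (C : fieldType) (N : nat) (Omega : functional C N) :=
  GRing.isLinear.Build C {poly C} C *%R (pairing Omega)
    (pairing_is_scalar Omega).

(** Indexed by its order, so [D_n] is the determinant of [hankel_mx L n.+1]. *)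
Definition hankel_mx {C : fieldType} (L : {poly C} -> C) (n : nat) : 'M[C]_n :=
  \matrix_(i, j) L 'X^(i + j).

Lemma det_gram {C : fieldType} (L : {scalar {poly C}})
    (q : nat -> {poly C}) (n : nat) :
    (forall i, (i < n)%N -> size (q i) = i.+1) ->
  \det (\matrix_(i < n, j < n) L (q i * q j))
  = (\prod_(i < n) lead_coef (q i)) ^+ 2 * \det (hankel_mx L n).
Proof.
move=> sq; pose T : 'M[C]_n := \matrix_(i, j) (q i)`_j.
have qE (i : 'I_n) : q i = \sum_(k < n) (q i)`_k *: 'X^k.
  rewrite -poly_def; apply/polyP => k; rewrite coef_poly.
  case: ltnP => // le_nk.
  by rewrite nth_default // sq // (leq_trans _ le_nk).
have -> : \matrix_(i, j) L (q i * q j) = T *m hankel_mx L n *m T^T.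
  apply/matrixP => i j; rewrite !mxE [in LHS](qE i) [in LHS](qE j).
  rewrite mulr_sumr linear_sum; apply: eq_bigr => l _; rewrite !mxE.
  rewrite [in LHS]mulr_suml linear_sum mulr_suml.
  apply: eq_bigr => k _; rewrite !mxE.
  rewrite -scalerAl -scalerAr -exprD !linearZ /=.
  by rewrite mulrA mulrAC.
(* As [q i] has degree [i], [T] is lower triangular with the leading coefficients on its
   diagonal. *)
have detT : \det T = \prod_(i < n) lead_coef (q i).
  rewrite det_trig.
    by apply: eq_bigr => i _; rewrite mxE lead_coefE sq.
  by apply/is_trig_mxP => i j lt_ij; rewrite mxE nth_default // sq.
by rewrite !det_mulmx det_tr detT mulrAC expr2.
Qed.

(** By orthogonality the Gram determinant is the product of the squares [L (q i * q i)]. Nothing is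
    normalized, so isotropic members are allowed. *)
Lemma det_hankel_eq0 {C : fieldType} (L : {scalar {poly C}})
    (q : nat -> {poly C}) (n : nat) :
    (forall i, (i < n)%N -> size (q i) = i.+1) ->
    (forall i j, (j < i < n)%N -> L (q i * q j) = 0) ->
  (\det (hankel_mx L n) == 0) = [exists i : 'I_n, L (q i * q i) == 0].
Proof.
move=> sq oq; have lead0 : \prod_(i < n) lead_coef (q i) != 0.
  by apply/prodf_neq0 => i _; rewrite lead_coef_eq0 -size_poly_eq0 sq.
have := det_gram L q n sq; rewrite det_trig; last first.
  by apply/is_trig_mxP => i j lt_ij; rewrite mxE mulrC oq // lt_ij /=.
move=> gramE.
have -> : (\det (hankel_mx L n) == 0)
    = ((\prod_(i < n) lead_coef (q i)) ^+ 2 * \det (hankel_mx L n) == 0).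
  by rewrite mulf_eq0 expf_eq0 (negPf lead0).
rewrite -gramE.
apply/prodf_eq0/existsP => [[i _]|[i Li0]].
  by rewrite mxE => Li0; exists i.
by exists i; rewrite // mxE.
Qed.

(** * Orthonormalization by the three-term recurrence *)

(** A Gram-Schmidt step: for orthonormal [p] and [q], the projections of ['X * q] on both are
    removed. *)
Definition ortho_residual {C : fieldType} (L : {poly C} -> C)
    (p q : {poly C}) : {poly C} :=
  'X * q - L ('X * q * q) *: q - L ('X * q * p) *: p.

(* Taking 1 for isotropic polynomials is the convention a_(N-1) = 1. *)
Definition ortho_norm {C : numClosedFieldType} (L : {poly C} -> C)
    (r : {poly C}) : C :=
  if L (r * r) == 0 then 1 else sqrtC (L (r * r)).

(* The pair (P_(n-1), P_n), with P_(-1) = 0. *)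
Fixpoint ortho_pair {C : numClosedFieldType} (L : {poly C} -> C) (n : nat) :
    {poly C} * {poly C} :=
  if n is k.+1 then
    let: (p, q) := ortho_pair L k in
    let r := ortho_residual L p q in (q, (ortho_norm L r)^-1 *: r)
  else (0, 1).

Definition ortho_poly {C : numClosedFieldType} (L : {poly C} -> C) (n : nat) :
  {poly C} := (ortho_pair L n).2.

Definition ortho_a {C : numClosedFieldType} (L : {poly C} -> C) (n : nat) : C :=
  ortho_norm L (ortho_residual L (ortho_pair L n).1 (ortho_pair L n).2).

Definition ortho_b {C : numClosedFieldType} (L : {poly C} -> C) (n : nat) : C :=
  L ('X * ortho_poly L n * ortho_poly L n).

(* The recurrence subtracts c_n P_n where the Jacobi recurrence has a_n P_n; the
   two agree once P_(n+1) is normalized (ortho_cE). *)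
Definition ortho_c {C : numClosedFieldType} (L : {poly C} -> C) (n : nat) : C :=
  L ('X * ortho_poly L n.+1 * ortho_poly L n).

Lemma ortho_norm_neq0 {C : numClosedFieldType} (L : {poly C} -> C) r :
  ortho_norm L r != 0.
Proof.
by rewrite /ortho_norm; case: ifPn => [_|L0]; rewrite ?oner_neq0 ?sqrtC_eq0.
Qed.

Lemma ortho_pair1 {C : numClosedFieldType} (L : {poly C} -> C) n :
  (ortho_pair L n.+1).1 = ortho_poly L n.
Proof. by rewrite /ortho_poly /=; case: ortho_pair. Qed.

Lemma ortho_polyS {C : numClosedFieldType} (L : {poly C} -> C) n :
  ortho_poly L n.+1 = (ortho_a L n)^-1 *:
    ortho_residual L (ortho_pair L n).1 (ortho_pair L n).2.
Proof. by rewrite /ortho_a /ortho_poly /=; case: ortho_pair. Qed.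

Lemma ortho_residual0 {C : numClosedFieldType} (L : {poly C} -> C) :
  ortho_residual L (ortho_pair L 0).1 (ortho_pair L 0).2
  = 'X * ortho_poly L 0 - ortho_b L 0 *: ortho_poly L 0.
Proof. by rewrite /ortho_residual /= scaler0 subr0. Qed.

Lemma ortho_residualS {C : numClosedFieldType} (L : {poly C} -> C) n :
  ortho_residual L (ortho_pair L n.+1).1 (ortho_pair L n.+1).2
  = 'X * ortho_poly L n.+1 - ortho_b L n.+1 *: ortho_poly L n.+1
    - ortho_c L n *: ortho_poly L n.
Proof. by rewrite ortho_pair1. Qed.

(** Valid for every [L], since [ortho_norm] never vanishes. It serves to expand a pairing after ['X]
    is moved to the other factor. *)
Lemma ortho_recE {C : numClosedFieldType} (L : {poly C} -> C) n :
  'X * ortho_poly L n = ortho_a L n *: ortho_poly L n.+1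
    + ortho_b L n *: ortho_poly L n
    + (if n is k.+1 then ortho_c L k *: ortho_poly L k else 0).
Proof.
rewrite ortho_polyS scalerA divff ?ortho_norm_neq0 // scale1r.
case: n => [|n]; first by rewrite ortho_residual0 subrK addr0.
by rewrite ortho_residualS addrAC !subrK.
Qed.

Lemma size_ortho_poly {C : numClosedFieldType} (L : {poly C} -> C) n :
  size (ortho_poly L n) = n.+1.
Proof.
elim/ltn_ind: n => -[|n] IH; first by rewrite /ortho_poly size_poly1.
have qn0 : ortho_poly L n != 0 by rewrite -size_poly_eq0 IH.
have sX : size ('X * ortho_poly L n) = n.+2.
  by rewrite mulrC size_mulX // IH.
rewrite ortho_polyS size_scale ?invr_eq0 ?ortho_norm_neq0 //.
have sZ c k : (k <= n)%N -> (size (- (c *: ortho_poly L k)) < n.+2)%N.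
  move=> le_kn.
  by rewrite size_polyN ltnS (leq_trans (size_scale_leq _ _)) // IH.
have sb : size ('X * ortho_poly L n - ortho_b L n *: ortho_poly L n) = n.+2.
  by rewrite size_polyDl sX // sZ.
case: n {IH qn0} sX sZ sb => [|n] sX sZ sb; first by rewrite ortho_residual0.
by rewrite ortho_residualS size_polyDl sb // sZ.
Qed.

(** Dividing by [ortho_norm] makes the square 1, unless the residual is isotropic and the square
    stays 0. *)
Lemma ortho_square {C : numClosedFieldType} (L : {scalar {poly C}}) n :
  L 1 = 1 -> L (ortho_poly L n * ortho_poly L n) != 0 ->
  L (ortho_poly L n * ortho_poly L n) = 1.
Proof.
move=> L1; case: n => [|n]; first by rewrite /ortho_poly /= mulr1.
rewrite ortho_polyS /ortho_a; set r := ortho_residual _ _ _.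
rewrite -scalerAl -scalerAr !linearZ /=.
rewrite /ortho_norm; have [->|Lr0 _] := eqVneq (L (r * r)) 0.
  by rewrite !mulr0 eqxx.
by rewrite mulrA -invfM -expr2 sqrtCK mulVf.
Qed.

(** Orthogonality reaches [P_n], one index beyond normalization: determinants of order at most [n]
    control only the squares of [P_0, ..., P_(n-1)]. *)
Lemma ortho_polyP {C : numClosedFieldType} (L : {scalar {poly C}}) n :
    L 1 = 1 -> (forall k, (0 < k <= n)%N -> \det (hankel_mx L k) != 0) ->
  (forall i j, (j < i <= n)%N -> L (ortho_poly L i * ortho_poly L j) = 0) /\
  (forall i, (i < n)%N -> L (ortho_poly L i * ortho_poly L i) = 1).
Proof.
move=> L1; elim: n => [|n IHn] Hdet; first by split=> // i j; lia.
have [|oP nP] := IHn; first by move=> k lek; apply: Hdet; lia.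
have nPn i : (i < n.+1)%N -> L (ortho_poly L i * ortho_poly L i) = 1.
  rewrite ltnS => le_in; apply: ortho_square => //.
  (* The determinant of order [n.+1] can be nonzero only if none of [P_0, ..., P_n] is isotropic. *)
  have := Hdet n.+1; rewrite ltnSn => /(_ isT).
  rewrite (@det_hankel_eq0 _ L (ortho_poly L)); last 2 first.
  - by move=> k _; exact: size_ortho_poly.
  - by move=> k j; exact: oP.
  by move=> /existsPn /(_ (Ordinal (le_in : (i < n.+1)%N))).
split=> // i j /andP[lt_ji]; rewrite leq_eqVlt => /predU1P[Ei|]; last first.
  by move=> le_in; apply: oP; rewrite lt_ji.
rewrite {}Ei ltnS in lt_ji * => {i}.
have oPn i k : (i <= n)%N -> (k <= n)%N ->
    L (ortho_poly L i * ortho_poly L k) = (i == k)%:R.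
  move=> le_in le_kn; case: (ltngtP i k) => [lt_ik|lt_ki|->].
  - by rewrite mulrC oP // lt_ik.
  - by rewrite oP // lt_ki.
  - exact: nPn.
rewrite ortho_polyS -scalerAl linearZ /=.
suff -> : L (ortho_residual L (ortho_pair L n).1 (ortho_pair L n).2
     * ortho_poly L j) = 0 by rewrite mulr0.
case: n {IHn Hdet oP nP nPn} oPn lt_ji => [|n] oPn lt_ji.
  have -> : j = 0%N by lia.
  rewrite ortho_residual0 mulrBl linearB -scalerAl linearZ /=.
  by rewrite oPn // eqxx [X in _ - X]mulr1 subrr.
(* The coefficients b and c cancel the pairings with [P_(n+1)] and [P_n]. *)
rewrite ortho_residualS !mulrBl !linearB -!scalerAl !linearZ /= !oPn //.
have [->|ne_jn1] := eqVneq j n.+1.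
  by rewrite ltn_eqF // mulr0 subr0 mulr1 subrr.
have [->|ne_jn] := eqVneq j n; first by rewrite mulr0 subr0 mulr1 subrr.
rewrite !mulr0 !subr0.
(* For [j < n], moving ['X] onto [P_j] yields only polynomials of index at most [n], all orthogonal
   to [P_(n+1)]. *)
rewrite -mulrA mulrCA ortho_recE !mulrDr !linearD -!scalerAr !linearZ /=.
rewrite !oPn //; last by lia.
rewrite eqSS ![_ == j]eq_sym (negPf ne_jn1) (negPf ne_jn) !mulr0 !add0r.
case: j lt_ji ne_jn1 ne_jn => [|j] lt_ji _ ne_jn; first by rewrite mulr0 raddf0.
by rewrite -scalerAr linearZ /= oPn ?gtn_eqF ?mulr0 //; lia.
Qed.

(** When ['X * P_n] is expanded and paired with [P_(n+1)], only the term [a_n P_(n+1)] survives. *)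
Lemma ortho_cE {C : numClosedFieldType} (L : {scalar {poly C}}) n :
    (forall i, (i < n.+1)%N -> L (ortho_poly L n.+1 * ortho_poly L i) = 0) ->
    L (ortho_poly L n.+1 * ortho_poly L n.+1) = 1 ->
  ortho_c L n = ortho_a L n.
Proof.
move=> oP Ln; rewrite /ortho_c -mulrA mulrCA ortho_recE.
rewrite !mulrDr !linearD -!scalerAr !linearZ /= Ln (oP n) //.
case: n oP {Ln} => [|n] oP; first by rewrite !mulr0 raddf0 mulr1 !addr0.
by rewrite -scalerAr linearZ /= oP // !mulr0 mulr1 !addr0.
Qed.

(** * The Jacobi matrix of the recurrence coefficients *)

Definition ortho_jacobi {C : numClosedFieldType} (L : {poly C} -> C) (N : nat) :
    'M[C]_N :=
  \matrix_(i, j) if j == i :> nat then ortho_b L i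
                 else if j == i.+1 :> nat then ortho_a L i
                 else if i == j.+1 :> nat then ortho_a L j else 0.

Lemma is_jacobi_ortho {C : numClosedFieldType} (L : {poly C} -> C) N :
  is_jacobi (ortho_jacobi L N).
Proof.
split.
- apply/matrixP => i j; rewrite !mxE.
  case: (ltngtP i j) => [lt_ij|lt_ji|->] //.
    by rewrite (ltn_eqF (ltnW lt_ij : (i < j.+1)%N)).
  by rewrite (ltn_eqF (ltnW lt_ji : (j < i.+1)%N)).
- by move=> i j lt_ij; rewrite mxE !ifN //; lia.
- by move=> i j eq_ji; rewrite mxE eq_ji eqxx ifN ?ortho_norm_neq0 //; lia.
Qed.

Lemma jacobi_b_ortho {C : numClosedFieldType} (L : {poly C} -> C) N n :
  (n < N)%N -> jacobi_b (ortho_jacobi L N) n = ortho_b L n.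
Proof. by move=> lt_nN; rewrite /jacobi_b insubT mxE eqxx. Qed.

Lemma jacobi_a_ortho {C : numClosedFieldType} (L : {poly C} -> C) N n :
  (n.+1 < N)%N -> jacobi_a (ortho_jacobi L N) n = ortho_a L n.
Proof.
move=> lt_nN; rewrite /jacobi_a !insubT ?(ltnW lt_nN) // => h.
by rewrite mxE /= eqxx ifN //; lia.
Qed.

Lemma jacobi_a_last {C : fieldType} N (J : 'M[C]_N) :
  jacobi_a J N.-1 = 1.
Proof.
rewrite /jacobi_a; case: insubP => // i _ _; case: insubP => // j; lia.
Qed.

(** The residual is a multiple of [P_(n+1)], hence isotropic too, and [ortho_norm] takes its default
    value. *)
Lemma ortho_a_isotropic {C : numClosedFieldType} (L : {scalar {poly C}}) n :
  L (ortho_poly L n.+1 * ortho_poly L n.+1) = 0 -> ortho_a L n = 1.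
Proof.
move=> Ln; have := ortho_polyS L n; rewrite {2}/ortho_a.
set r := ortho_residual _ _ _ => PE; rewrite /ortho_a -/r /ortho_norm.
suff -> : L (r * r) = 0 by rewrite eqxx.
have -> : r = ortho_a L n *: ortho_poly L n.+1.
  by rewrite PE scalerA divff ?ortho_norm_neq0 // scale1r.
by rewrite -scalerAl -scalerAr !linearZ /= Ln !mulr0.
Qed.

(** The hypotheses match the coefficients of the two recurrences, the second one at the boundary
    index, where [jacobi_a] is 1 by convention. *)
Lemma jacobi_poly_ortho {C : numClosedFieldType} (L : {poly C} -> C) N :
    (forall n, (n.+1 < N)%N -> ortho_c L n = ortho_a L n) ->
    ortho_a L N.-1 = 1 ->
  forall n, (n <= N)%N -> jacobi_poly (ortho_jacobi L N) n = ortho_poly L n.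
Proof.
move=> ca aN; elim/ltn_ind => -[//|n] IHn lt_nN.
have aE : jacobi_a (ortho_jacobi L N) n = ortho_a L n.
  have [lt_n1N|le_Nn1] := ltnP n.+1 N; first exact: jacobi_a_ortho.
  have -> : n = N.-1 by lia.
  by rewrite jacobi_a_last aN.
rewrite ortho_polyS [LHS]/= aE jacobi_b_ortho // IHn ?(ltnW lt_nN) //.
rewrite mulrBl mul_polyC; case: n {aE} IHn lt_nN => [|n] IHn lt_nN.
  by rewrite ortho_residual0 subr0.
by rewrite ortho_residualS jacobi_a_ortho // IHn ?ca //; lia.
Qed.

Theorem theorem3 (R : realType) (N : nat) (N_gt0 : (0 < N)%N)
    (Omega : {linear {poly_(2 * N).+1 R[i]} -> R[i]^o}) :
  (exists J : 'M[R[i]]_N,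
     is_jacobi J /\ is_generalized_spectral_function J Omega)
  <->
  [/\ hankel_det Omega 0 = 1,
      forall n : nat, (0 < n < N)%N -> hankel_det Omega n != 0
    & hankel_det Omega N = 0].
Proof.
have hankelE n : hankel_det Omega n =
  \det (hankel_mx (pairing Omega) n.+1) by [].
have D0 : hankel_det Omega 0 = pairing Omega 1.
  by rewrite hankelE det_mx11 mxE.
split=> [[J [hJ [on oN]]]|[]].
  (* Necessity: [P_0, ..., P_(N-1)] have square 1, so [D_n] is nonzero for [n < N], while the
     isotropic [P_N] makes [D_N] vanish. *)
  have oJ i j : (j < i <= N)%N ->
      pairing Omega (jacobi_poly J i * jacobi_poly J j) = 0.
    case/andP=> lt_ji; rewrite leq_eqVlt => /predU1P[Ei|lt_iN].
      by rewrite Ei mulrC oN // -Ei ltnW.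
    by rewrite on ?(ltn_trans lt_ji) // gtn_eqF.
  have DE n : (n <= N)%N -> (hankel_det Omega n == 0) = [exists i : 'I_n.+1,
      pairing Omega (jacobi_poly J i * jacobi_poly J i) == 0].
    move=> le_nN.
    rewrite hankelE (det_hankel_eq0 (pairing Omega) (jacobi_poly J)) //.
      by move=> i _; rewrite size_jacobi_poly.
    move=> i j /andP[lt_ji lt_in] /=.
    by rewrite oJ // lt_ji (leq_trans _ le_nN).
  split.
  - by rewrite D0 -(mulr1 1) (on 0 0).
  - move=> n /andP[_ lt_nN]; rewrite DE ?(ltnW lt_nN) //.
    apply/existsPn => i; rewrite on ?eqxx ?oner_neq0 //.
      by rewrite (leq_trans (ltn_ord i)).
    by rewrite (leq_trans (ltn_ord i)).
  - by apply/eqP; rewrite DE //; apply/existsP; exists ord_max; rewrite oN.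
(* Sufficiency: the pairing itself is orthonormalized, up to index [N]. *)
move=> D0_1 Dn DN; pose L : {scalar {poly R[i]}} := pairing Omega.
have L1 : L 1 = 1 by rewrite /L /= -D0.
have detL k : (0 < k <= N)%N -> \det (hankel_mx L k) != 0.
  case: k => [|[|k]] // le_kN; last exact: Dn.
  by rewrite -[X in X != 0]/(hankel_det Omega 0) D0_1 oner_neq0.
have [oP nP] := ortho_polyP L N L1 detL.
(* [D_N = 0] forces some [P_i] with [i <= N] to be isotropic; those below [N] have square 1, so
   [i = N]. *)
have isoN : L (ortho_poly L N * ortho_poly L N) = 0.
  have /eqP := DN; rewrite hankelE (det_hankel_eq0 L (ortho_poly L)) //.
  - case/existsP => i; have := ltn_ord i; rewrite ltnS leq_eqVlt.
    by case/predU1P => [-> /eqP //|lt_iN]; rewrite nP // oner_eq0.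
  - by move=> i _; exact: size_ortho_poly.
pose J : 'M[R[i]]_N := ortho_jacobi L N.
exists J; split; first exact: is_jacobi_ortho.
have JP n : (n <= N)%N -> jacobi_poly J n = ortho_poly L n.
  apply: jacobi_poly_ortho => [k lt_kN|].
    by apply: ortho_cE => [i lt_ik|]; [apply: oP; lia | exact: nP].
  by apply: ortho_a_isotropic; rewrite prednK.
split=> [m n lt_mN lt_nN|m le_mN].
  rewrite !JP ?(ltnW lt_mN) ?(ltnW lt_nN) //.
  have [lt_mn|lt_nm|->] := ltngtP m n; last exact: nP.
    by rewrite mulrC; apply: oP; rewrite lt_mn ltnW.
  by apply: oP; rewrite lt_nm ltnW.
rewrite !JP //; move: le_mN; rewrite leq_eqVlt => /predU1P[->//|lt_mN].
by rewrite mulrC; apply: oP; rewrite lt_mN leqnn.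
Qed.
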